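(* Let $f=m_1+\dots+m_t$ be a $d$-intersecting, $k$-homogeneous $n$-variable Boolean function, where $m_1,\dots,m_t$ are the distinct monomials of its ANF. Then \[|N_k(f)|=\sum_{\ell=1}^{t}(-2)^{\ell-1}\binom{t}{\ell}\,2^{k(n-\ell k+(\ell-1)d)}\prod_{i=0}^{k-d-1}\left(2^k-2^{i+d}\right)^{\ell-1}.\]
   Context: An $n$-variable Boolean function $f\colon\mathbb{F}_2^n\to\mathbb{F}_2$ is written in algebraic normal form (ANF) as a sum of distinct monomials $x_I=\prod_{i\in I}x_i$, $I\subseteq[n]=\{1,\dots,n\}$; write $\mathrm{Var}(x_I)=I$. $f$ is $k$-homogeneous if all monomials of its ANF have degree $k$. For $0\le d\le n-1$, $f=m_1+\dots+m_t$ is $d$-intersecting if there is a subset $D\subseteq[n]$ with $|D|=d$ such that $\mathrm{Var}(m_i)\cap\mathrm{Var}(m_j)=D$ for all $i\neq j$ in $[t]$. $N_k(f)$ denotes the set of $k$-dimensional linear subspaces $U$ of $\mathbb{F}_2^n$ with $\sum_{x\in U}f(x)\neq 0$. *)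

(* Defs.v *)
From HB Require Import structures.
From mathcomp Require Import all_boot all_order all_algebra.
Set Implicit Arguments.
Unset Strict Implicit.
Unset Printing Implicit Defensive.
Import Order.TTheory GRing.Theory Num.Theory.
Local Open Scope ring_scope.

(* The library makes {vspace vT} a choiceType only; over a finite field it is
   finite, as a subtype of a matrix type, so #|_| is available for sets of
   subspaces. *)
Section VspaceFinite.
Import VectorInternalTheory.
Variables (K : finFieldType) (vT : vectType K).
HB.instance Definition _ := [Countable of {vspace vT} by <:].
HB.instance Definition _ := [Finite of {vspace vT} by <:].
End VspaceFinite.

Definition boolfun (n : nat) := {ffun 'rV['F_2]_n -> 'F_2}.

(* The monomial x_I is represented by its variable set I, and an ANF by the
   set of its monomials. *)
Definition monomial (n : nat) (I : {set 'I_n}) (x : 'rV['F_2]_n) : 'F_2 :=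
  \prod_(i in I) x 0 i.

Definition is_anf (n : nat) (f : boolfun n) (M : {set {set 'I_n}}) : bool :=
  [forall x, f x == \sum_(I in M) monomial I x].

(* The default value is never used, see [anfP]. *)
Definition anf (n : nat) (f : boolfun n) : {set {set 'I_n}} :=
  odflt set0 [pick M | is_anf f M].

Lemma is_anf_inj (n : nat) (f : boolfun n) (M M' : {set {set 'I_n}}) :
  is_anf f M -> is_anf f M' -> M = M'.
Proof.
move=> /forallP fM /forallP fM'.
pose chi (I : {set 'I_n}) : 'rV['F_2]_n := \row_i (i \in I)%:R.
have mchi I J : monomial J (chi I) = (J \subset I)%:R.
  rewrite /monomial; case: (boolP (J \subset I)) => [/subsetP JI|].
    by apply: big1 => i /JI iI; rewrite mxE iI.
  by case/subsetPn=> i iJ iI; rewrite (bigD1 i) //= mxE (negPf iI) mul0r.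
have sumE (N : {set {set 'I_n}}) I : \sum_(J in N) monomial J (chi I)
    = (I \in N)%:R + \sum_(J in N | J \proper I) 1.
  rewrite (eq_bigr (fun J : {set 'I_n} => if J \subset I then 1 else 0 : 'F_2));
    last by move=> J _; rewrite mchi; case: (_ \subset _).
  rewrite -big_mkcondr /= -[in RHS](mulr1n 1%R).
  case: (boolP (I \in N)) => IN.
    rewrite (bigD1 I) /= ?IN ?subxx //; congr (_ + _).
    by apply: eq_bigl => J; rewrite properEneq -andbA [(_ \subset _) && _]andbC.
  rewrite add0r; apply: eq_bigl => J; rewrite properEneq.
  by case: eqVneq => [->|//]; rewrite (negPf IN).
apply/setP => I; have [m] := ubnP #|I|; elim: m I => // m IHm I ltIm.
have: \sum_(J in M) monomial J (chi I) = \sum_(J in M') monomial J (chi I).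
  by rewrite -(eqP (fM _)) (eqP (fM' _)).
rewrite !sumE.
have -> : \sum_(J in M | J \proper I) 1 = \sum_(J in M' | J \proper I) 1 :> 'F_2.
  apply: eq_bigl => J; case: (boolP (J \proper I)) => JI; rewrite ?andbF //.
  by rewrite IHm // (leq_trans (proper_card JI)).
by move/addIr; do 2 case: (_ \in _).
Qed.

Lemma anfP (n : nat) (f : boolfun n) (M : {set {set 'I_n}}) :
  is_anf f M = (M == anf f).
Proof.
have [N fN] : exists N, is_anf f N.
  pose F (N : {set {set 'I_n}}) : boolfun n :=
    [ffun x => \sum_(I in N) monomial I x].
  have F_anf N : is_anf (F N) N by apply/forallP => x; rewrite ffunE.
  have F_inj : injective F.
    by move=> N N' eqF; apply: (is_anf_inj (F_anf N)); rewrite eqF.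
  have [|G _ GK] := inj_card_bij F_inj; last by exists (G f); rewrite -{1}(GK f).
  rewrite card_ffun card_mx !card_Fp // mul1n -cardsT -powersetT card_powerset.
  by rewrite cardsT -cardsT -powersetT card_powerset cardsT card_ord.
have anf_f : is_anf f (anf f).
  by rewrite /anf; case: pickP => [//|/(_ N)]; rewrite fN.
by apply/idP/eqP => [fM|-> //]; apply: is_anf_inj anf_f.
Qed.

Definition homogeneous (k n : nat) (f : boolfun n) : Prop :=
  {in anf f, forall I : {set _}, #|I| = k}.

Definition d_intersecting (d n : nat) (f : boolfun n) : Prop :=
  (d < n)%N /\
  exists2 D : {set 'I_n}, #|D| = d &
    {in anf f &, forall I J : {set _}, I != J -> I :&: J = D}.

Definition Nset (k n : nat) (f : boolfun n) : {set {vspace 'rV['F_2]_n}} :=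
  [set U : {vspace 'rV['F_2]_n} | (\dim U == k) && (\sum_(x in U) f x != 0)].

(* Main.v *)
Require Import Defs.
From mathcomp Require Import all_boot all_order all_algebra.
From mathcomp Require mxabelem.
From mathcomp Require Import ring.
Set Implicit Arguments.
Unset Strict Implicit.
Unset Printing Implicit Defensive.
Import Order.TTheory GRing.Theory Num.Theory.
Local Open Scope ring_scope.

(* Describe a k-dimensional U by a basis, the columns of an n x k matrix W, so
   that each U arises from |GL_k| matrices.  The sum over U of a monomial x_I of
   degree k is the number mod 2 of c with (W c)_i = 1 for all i in I: it is 1 if
   the rows of W indexed by I are independent, and 0 otherwise.  So U is in
   N_k(f) iff an odd number of monomials of f select independent rows, and the
   parity of the size of a set A is the sum of (-2)^(|S|-1) over its nonempty
   subsets S.  For a fixed S of size l, the matrices W for which every I in S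
   selects independent rows are counted by choosing rows one at a time: once the
   rows of the kernel D are independent, the sets I \ D are disjoint and can be
   filled in independently of each other. *)

Lemma natr_card (T : finType) (P : pred T) :
  #|[set x | P x]|%:R = \sum_x (P x)%:R :> rat.
Proof.
rewrite -sum1dep_card natr_sum big_mkcond.
by apply: eq_bigr => x _; case: (P x).
Qed.

(** * Matrices whose rows in a given index set are independent *)

Section FreeRows.
Variables (F : finFieldType) (n k : nat).
Implicit Types (W : 'M[F]_(n, k)) (X Y I : {set 'I_n}) (Q : pred 'M[F]_(n, k)).

(** [<<_>>] turns each row into a square matrix, so that all summands share the type on which the
    big sum operates. *)
Definition rows_span X W : 'M_k := (\sum_(i in X) <<row i W>>)%MS.

Definition rows_free X W := \rank (rows_span X W) == #|X|.

Lemma rank_rows_span X W : (\rank (rows_span X W) <= #|X|)%N.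
Proof.
rewrite /rows_span -sum1_card; elim/big_rec2: _ => [|i r A _ le_rA].
  by rewrite mxrank0.
apply: leq_trans (mxrank_adds_leqif _ _).1 _.
by rewrite leq_add // mxrank_gen rank_leq_row.
Qed.

Lemma eq_rows_span X W W' :
  {in X, forall i, row i W = row i W'} -> rows_span X W = rows_span X W'.
Proof. by move=> eqW; apply: eq_bigr => i /eqW ->. Qed.

Lemma eq_rows_free X W W' :
  {in X, forall i, row i W = row i W'} -> rows_free X W = rows_free X W'.
Proof. by move=> eqW; rewrite /rows_free (eq_rows_span eqW). Qed.

Lemma rows_free0 W : rows_free set0 W.
Proof. by rewrite /rows_free /rows_span big_set0 mxrank0 cards0. Qed.

(** Rank is subadditive: the rows in [Y :\: X] add at most their number, so full rank on [Y] leaves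
    no deficit on [X]. *)
Lemma rows_free_sub X Y W : X \subset Y -> rows_free Y W -> rows_free X W.
Proof.
move=> sXY /eqP freeY; rewrite /rows_free eqn_leq rank_rows_span /=.
rewrite -(leq_add2r #|Y :\: X|) -{1}(setIidPr sXY) cardsID -freeY.
rewrite {1}/rows_span (big_setID X) /= (setIidPr sXY).
apply: leq_trans (mxrank_adds_leqif _ _).1 _.
by rewrite leq_add2l rank_rows_span.
Qed.

Lemma rows_freeU1 j X W : j \notin X ->
  rows_free (j |: X) W = rows_free X W && ~~ (row j W <= rows_span X W)%MS.
Proof.
move=> jX; rewrite /rows_free {1}/rows_span big_setU1 //= -/(rows_span X W).
rewrite cardsU1 jX; case: (boolP (row j W <= _)%MS) => [sub | nsub].
  have sub' : (<<row j W>> <= rows_span X W)%MS by rewrite genmxE.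
  by rewrite (addsmx_idPr sub') andbF ltn_eqF // add1n ltnS rank_rows_span.
rewrite andbT.
(* A row has rank at most 1, so a proper subspace of its span is zero and the dimension formula adds
   the ranks without loss. *)
have lt_cap : (\rank (row j W :&: rows_span X W)%MS < \rank (row j W))%N.
  rewrite (ltn_leqif (mxrank_leqif_sup (capmxSl _ _))).
  by apply: contra nsub => /submx_trans; apply; apply: capmxSr.
have row1 := rank_leq_row (row j W).
have cap0 : \rank (row j W :&: rows_span X W)%MS = 0%N.
  by apply/eqP; rewrite -leqn0 -ltnS (leq_trans lt_cap).
have := mxrank_sum_cap (row j W) (rows_span X W).
rewrite cap0 addn0 (adds_eqmx (genmxE _) (eqmx_refl _)) => ->.
suff -> : \rank (row j W) = 1%N by rewrite eqn_add2l.
by apply/eqP; rewrite eqn_leq row1; rewrite cap0 in lt_cap.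
Qed.

Definition set_row j (v : 'rV[F]_k) W : 'M_(n, k) :=
  \matrix_i (if i == j then v else row i W).

Lemma row_set_row j v W i :
  row i (set_row j v W) = if i == j then v else row i W.
Proof. by rewrite rowK. Qed.

(** Once the other rows are fixed, the values of row [j] outside the span of the rows in [X] are the
    complement of a space of dimension [#|X|]. The factor [#|F| ^+ k] on the left counts a spare row
    and avoids a division. *)
Lemma card_rows_free_step Q j X : j \notin X ->
    (forall W v, Q (set_row j v W) = Q W) ->
    (forall W, Q W -> rows_free X W) ->
  #|[set W | Q W && rows_free (j |: X) W]|%:R * #|F|%:R ^+ k
  = #|[set W | Q W]|%:R * (#|F|%:R ^+ k - #|F|%:R ^+ #|X|) :> rat.
Proof.
move=> jX Qj QX.
pose A W : {set 'rV_k} := [set v | ~~ (v <= rows_span X W)%MS].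
have cardA W : Q W -> #|A W|%:R = #|F|%:R ^+ k - #|F|%:R ^+ #|X| :> rat.
  move=> QW; have cardC : #|~: A W| = (#|F| ^ #|X|)%N.
    rewrite -(eqP (QX _ QW)) -mxabelem.card_rowg; apply: eq_card => v.
    by rewrite !inE negbK.
  have := cardsC (A W); rewrite cardC card_mx mul1n => eqC.
  by rewrite -!natrX -eqC natrD addrK.
(* [s] exchanges row [j] of [W] with [v]: a pair whose [v] lies outside the span
   becomes a pair whose row [j] does, with [v] arbitrary. *)
pose s (p : 'M[F]_(n, k) * 'rV[F]_k) := (set_row j p.2 p.1, row j p.1).
have sK : involutive s.
  case=> W v; rewrite /s /= row_set_row eqxx; congr (_, _).
  by apply/row_matrixP => i; rewrite !row_set_row; case: eqP => [->|].
have Aj W v : A (set_row j v W) = A W.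
  apply/setP=> u; rewrite !inE; congr (~~ (_ <= _)%MS).
  apply: eq_rows_span => i iX; rewrite row_set_row.
  by case: eqP jX => // <-; rewrite iX.
transitivity (\sum_W \sum_(v : 'rV[F]_k) (Q W && (v \in A W))%:R : rat).
  rewrite pair_big (reindex_inj (inv_inj sK)) /=.
  rewrite -(pair_big xpredT xpredT (fun W v =>
    (Q (set_row j v W) && (row j W \in A (set_row j v W)))%:R)) /=.
  rewrite natr_card mulr_suml; apply: eq_bigr => W _.
  under eq_bigr do rewrite Qj Aj.
  rewrite big_const iter_addr_0 card_mx mul1n -[RHS]mulr_natr natrX.
  congr (_%:R * _); rewrite rows_freeU1 // inE.
  by case: (boolP (Q W)) => //= /QX ->.
rewrite natr_card mulr_suml; apply: eq_bigr => W _.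
case: (boolP (Q W)) => [QW|_] /=; last by rewrite mul0r big1.
rewrite mul1r -(cardA W QW) -natr_card; congr (_%:R).
by apply: eq_card => v; rewrite !inE.
Qed.

(** The rows in [Y :\: X] are added one at a time. As [Q] does not depend on them, each only has to
    avoid the span of the earlier ones. *)
Lemma card_rows_free_ext Q X Y : X \subset Y ->
    (forall W W', (forall i, i \notin Y :\: X -> row i W = row i W') ->
       Q W = Q W') ->
    (forall W, Q W -> rows_free X W) ->
  #|[set W | Q W && rows_free Y W]|%:R * #|F|%:R ^+ (k * (#|Y| - #|X|))
  = #|[set W | Q W]|%:R
    * \prod_(#|X| <= i < #|Y|) (#|F|%:R ^+ k - #|F|%:R ^+ i) :> rat.
Proof.
elim: {Y}_.+1 {-2}Y (ltnSn #|Y|) => // m IHm Y leYm sXY QE QX.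
have [/eqP eqXY|] := boolP (X == Y).
  rewrite -eqXY subnn muln0 expr0 big_geq // !mulr1; congr (_%:R).
  by apply: eq_card => W; rewrite !inE; case: (boolP (Q W)) => //= /QX ->.
rewrite eqEsubset sXY /= => /subsetPn[j jY jX].
have sXYj : X \subset Y :\ j by rewrite subsetD1 sXY.
have cardY : #|Y| = #|Y :\ j|.+1 by rewrite (cardsD1 j) jY.
have IH := IHm (Y :\ j) _ sXYj _ QX.
have jYj : j \notin Y :\ j by rewrite !inE eqxx.
(* Row [j] affects neither factor of [Q']: [j] lies in [Y :\: X] and outside [Y :\ j]. *)
pose Q' W := Q W && rows_free (Y :\ j) W.
have step := @card_rows_free_step Q' j (Y :\ j) jYj.
have leXY := subset_leq_card sXYj.
rewrite cardY subSn // mulnS exprD big_nat_recr //= mulrA.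
rewrite [RHS]mulrA -IH; first last.
- move=> W W' eqW; apply: QE => i; rewrite !inE => iXY; apply: eqW.
  by rewrite !inE; apply: contra iXY => /and3P[-> _ ->].
- by rewrite -cardY.
rewrite [RHS]mulrAC -step; first last.
- by move=> W /andP[].
- move=> W v; rewrite /Q'; congr (_ && _).
    apply: QE => i; rewrite !inE row_set_row; case: eqP => // ->.
    by rewrite jY jX.
  by apply: eq_rows_free => i; rewrite row_set_row !inE; case: eqP.
congr (_%:R * _ * _); apply: eq_card => W; rewrite !inE /Q' setD1K // -andbA.
case: (Q W) => //=; case: (boolP (rows_free Y W)); rewrite ?andbF // andbT.
by move/(rows_free_sub (subsetDl _ _)) => ->.
Qed.

End FreeRows.

(** * Simultaneous independence on a sunflower of row sets *)

Section Sunflower.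
Variables (F : finFieldType) (n k : nat).
Local Notation q := (#|F|%:R : rat).
Implicit Types (W : 'M[F]_(n, k)) (I J D : {set 'I_n}) (S : {set {set 'I_n}}).

Lemma card_rows_free I : #|I| = k ->
  #|[set W : 'M[F]_(n, k) | rows_free I W]|%:R * q ^+ (k * k)
  = q ^+ (n * k) * \prod_(0 <= i < k) (q ^+ k - q ^+ i).
Proof.
move=> cardI; have := @card_rows_free_ext F n k xpredT set0 I.
rewrite sub0set cards0 subn0 cardI => /(_ isT) ->; last 2 first.
- by [].
- by move=> W _; apply: rows_free0.
rewrite -[in RHS]natrX -(card_mx F n k); congr (_%:R * _).
by apply: eq_card => W; rewrite !inE.
Qed.

(** Induction removing one set [I]. A single set costs the full product; each further one only the
    factors from [#|D|] on, since its rows in [D] are already independent. *)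
Lemma card_rows_free_sunflower D S : S != set0 ->
    {in S, forall I, #|I| = k} ->
    {in S &, forall I J, I != J -> I :&: J = D} ->
  #|[set W : 'M[F]_(n, k) | [forall I in S, rows_free I W]]|%:R
    * (q ^+ (k * k) * q ^+ (k * (k - #|D|)) ^+ (#|S| - 1))
  = q ^+ (n * k) * \prod_(0 <= i < k) (q ^+ k - q ^+ i)
    * (\prod_(#|D| <= i < k) (q ^+ k - q ^+ i)) ^+ (#|S| - 1).
Proof.
elim: {S}_.+1 {-2}S (ltnSn #|S|) => // m IHm S leSm /set0Pn[I IS] homS intS.
have cardI := homS I IS.
have cardS : #|S| = #|S :\ I|.+1 by rewrite (cardsD1 I) IS.
have sS'S : {subset S :\ I <= S} by apply/subsetP; apply: subD1set.
have [S'0 | /set0Pn[J JS']] := eqVneq (S :\ I) set0.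
  rewrite cardS S'0 cards0 !expr0 !mulr1 -(card_rows_free cardI); congr (_%:R * _).
  apply: eq_card => W; rewrite !inE -(setD1K IS) S'0 setU0.
  by apply/forall_inP/idP => [|freeI K /set1P-> //]; apply; rewrite set11.
have JS := sS'S _ JS'; have neqIJ : I != J.
  by apply: contraTneq JS' => <-; rewrite !inE eqxx.
have eqD : I :&: J = D by apply: intS.
have sDI : D \subset I by rewrite -eqD subsetIl.
have sDJ : D \subset J by rewrite -eqD subsetIr.
pose Q W := [forall K in S :\ I, rows_free K W].
have ext := @card_rows_free_ext F n k Q D I sDI _ _.
have S'0 : S :\ I != set0 by apply/set0Pn; exists J.
have := IHm (S :\ I) _ S'0 _ _; rewrite -ltnS -cardS => /(_ leSm) IH.
have {IH} := IH (fun K KS => homS K (sS'S K KS))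
  (fun K L KS LS => intS K L (sS'S K KS) (sS'S L LS)).
have cardS' : (0 < #|S :\ I|)%N by rewrite card_gt0.
rewrite cardS subSS subn0 -(prednK cardS') subn1 /= => IH.
rewrite !exprSr (mulrA (_ * _) _ (\prod_(_ <= i < _) _)) -IH.
rewrite (mulrAC _ _ (\prod_(_ <= i < _) _)).
rewrite -[in X in \prod_(_ <= i < X) _]cardI -ext; first last.
(* The other petal [J] contains [D], so its independence gives that of the rows in [D]. *)
- by move=> W /forall_inP/(_ J JS'); apply: rows_free_sub.
(* An index in [I :\: D] lies in no other petal, so changing that row leaves [Q] unchanged. *)
- move=> W W' eqW; rewrite /Q; apply: eq_forallb_in => K KS'.
  apply: eq_rows_free => i iK; apply: eqW; rewrite !inE.
  apply: contraL iK => /andP[iD iI]; apply: contra iD => iK.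
  have /setD1P[neqKI KS] := KS'.
  by rewrite -(intS I K) // 1?eq_sym // inE iI.
rewrite cardI mulrA !(mulrAC _ (q ^+ (k * (k - _))) _) -!mulrA; congr (_%:R * _).
  apply: eq_card => W; rewrite !inE /Q -[in LHS](setD1K IS).
  apply/forall_inP/andP => [free|[/forall_inP free freeI] K].
    split; last by apply: free; rewrite setU11.
    by apply/forall_inP => K KS'; apply: free; rewrite setU1r.
  by case/setU1P => [->|/free].
Qed.

End Sunflower.

(** * Parity as a signed sum over subsets *)

Lemma sum_exp_subset (R : comPzRingType) (T : finType) (A : {set T}) (a : R) :
  \sum_(S : {set T} | S \subset A) a ^+ #|S| = (a + 1) ^+ #|A|.
Proof.
(* Elements outside [A] get the factor 0 + 1, so the product may run over all of [T] and be expanded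
   over its subsets; those not inside [A] pick up a zero. *)
have -> : (a + 1) ^+ #|A| = \prod_x ((if x \in A then a else 0) + 1).
  rewrite -prodr_const big_mkcond; apply: eq_bigr => x _.
  by case: ifP; rewrite ?add0r.
rewrite bigA_distr big_mkcond; apply: eq_bigr => S _; case: ifP => [sSA | /negbT].
  rewrite -prodr_const big_mkcond; apply: eq_bigr => x _.
  by case: ifP => // /(subsetP sSA) ->.
by case/subsetPn => x xS xA; rewrite (bigD1 x) //= xS (negPf xA) mul0r.
Qed.

(** At [a = -2] the sum over all subsets is (-1)^|A|, which is 1 minus twice the parity; dropping
    the empty set and dividing by -2 leaves the parity. *)
Lemma natr_odd_card (T : finType) (A : {set T}) :
  (odd #|A|)%:R =
    \sum_(S : {set T} | (S \subset A) && (S != set0)) (- 2) ^+ (#|S| - 1) :> rat.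
Proof.
apply: (@mulfI _ (- 2)) => //; rewrite mulr_sumr.
under eq_bigr => S /andP[_ S0] do
  rewrite -exprS subn1 prednK ?card_gt0 //.
have := sum_exp_subset A (- 2 : rat); rewrite (bigD1 set0) ?sub0set //= cards0 expr0.
have -> : - 2 + 1 = - 1 :> rat by [].
move/(canRL (addKr _)) => ->; rewrite -signr_odd.
by case: (odd _).
Qed.

Lemma sum_subset_card (R : pzRingType) (T : finType) (A : {set T}) (g : nat -> R) :
  \sum_(S : {set T} | (S \subset A) && (S != set0)) g #|S|
  = \sum_(1 <= l < #|A|.+1) 'C(#|A|, l)%:R * g l.
Proof.
rewrite big_add1 /= big_mkord.
transitivity (\sum_(i < #|A|)
    \sum_(S : {set T} | (S \subset A) && (#|S| == i.+1)) g i.+1); last first.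
  apply: eq_bigr => i _; rewrite sumr_const mulr_natl -cards_draws.
  by congr (_ *+ _); apply: eq_card => S; rewrite !inE.
rewrite (exchange_big_dep (fun S : {set T} => (S \subset A) && (S != set0))) /=.
  apply: eq_bigr => S /andP[sSA S0]; have lt0S : (0 < #|S|)%N by rewrite card_gt0.
  have ltSA : (#|S|.-1 < #|A|)%N by rewrite prednK // subset_leq_card.
  rewrite (big_pred1 (Ordinal ltSA)) /= ?prednK // => i.
  rewrite sSA /=; apply/eqP/eqP => [eqS | ->]; last by rewrite /= prednK.
  by apply: val_inj; rewrite /= eqS.
by move=> i S _ /andP[-> cardS]; rewrite -card_gt0 (eqP cardS).
Qed.

(** * Monomial sums and independence of rows *)

Section RowMask.
Variables (F : finFieldType) (n : nat).
Implicit Types (I : {set 'I_n}).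

(** The projection onto the coordinates in [I]: it turns row selection into a product, to which rank
    inequalities apply. *)
Definition row_mask I : 'M[F]_n := diag_mx (\row_i (i \in I)%:R).

Lemma row_row_mask I k (W : 'M[F]_(n, k)) i :
  row i (row_mask I *m W) = (i \in I)%:R *: row i W.
Proof. by rewrite mul_diag_mx; apply/rowP => j; rewrite !mxE. Qed.

Lemma rows_span_mask I k (W : 'M[F]_(n, k)) :
  (rows_span I W :=: row_mask I *m W)%MS.
Proof.
apply/eqmxP/andP; split.
  apply/sumsmx_subP => i iI; rewrite genmxE -[row i W]scale1r.
  have <- : (i \in I)%:R = 1 :> F by rewrite iI.
  by rewrite -row_row_mask row_sub.
apply/row_subP => i; rewrite row_row_mask.
case: (boolP (i \in I)) => iI; last by rewrite scale0r sub0mx.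
by rewrite scale1r (sumsmx_sup i) // genmxE.
Qed.

Lemma rank_row_mask I : (\rank (row_mask I) <= #|I|)%N.
Proof. by rewrite -[row_mask I]mulmx1 -rows_span_mask rank_rows_span. Qed.

Lemma rows_free_mask I k (W : 'M[F]_(n, k)) :
  rows_free I W = (\rank (W^T *m row_mask I) == #|I|).
Proof.
by rewrite /rows_free rows_span_mask -mxrank_tr trmx_mul tr_diag_mx.
Qed.

Lemma rows_free_setT k (W : 'M[F]_(n, k)) : rows_free setT W = row_free W.
Proof.
rewrite /rows_free rows_span_mask cardsT card_ord /row_free.
suff -> : row_mask setT = 1%:M by rewrite mul1mx.
by apply/matrixP => i j; rewrite !mxE inE.
Qed.
End RowMask.

Lemma F2_cases (x : 'F_2) : x = 0 \/ x = 1.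
Proof. by case: x => [[|[|//]]] ?; [left|right]; apply: val_inj. Qed.

(** At a coordinate [j] where [a] is 1, the shift by [a] exchanges the halves given by the value of
    [c] at [j]; their equal sums cancel in characteristic 2. *)
Lemma sum_shift_invariant_F2 k (g : 'rV['F_2]_k -> 'F_2) (a : 'rV_k) :
  a != 0 -> (forall c, g (c + a) = g c) -> \sum_c g c = 0.
Proof.
case/rV0Pn => j aj ga; have {}aj : a 0 j = 1 by case: (F2_cases (a 0 j)) aj => ->.
rewrite (bigID (fun c : 'rV_k => c 0 j == 0)) /=.
rewrite [X in _ + X](reindex_inj (addIr a)) /=.
rewrite [X in _ + X](eq_big (fun c : 'rV_k => c 0 j == 0) g); first last.
- by move=> c _; apply: ga.
- by move=> c; rewrite mxE aj; case: (F2_cases (c 0 j)) => ->.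
by rewrite -mulr2n -mulr_natl (_ : 2%:R = 0) ?mul0r //; apply: val_inj.
Qed.

Section MonomialSum.
Variables (n k : nat).

(** The monomial is 1 exactly when [c] solves the linear system [c *m M = o]. Full rank gives
    exactly one solution; otherwise the number of solutions is even, by invariance under a kernel
    vector. *)
Lemma sum_monomial (W : 'M['F_2]_(n, k)) (I : {set 'I_n}) : #|I| = k ->
  \sum_c monomial I (c *m W^T) = (rows_free I W)%:R.
Proof.
move=> cardI; pose M := W^T *m row_mask 'F_2 I.
pose o : 'rV['F_2]_n := const_mx 1 *m row_mask 'F_2 I.
have maskE (x : 'rV['F_2]_n) i : (x *m row_mask 'F_2 I) 0 i = x 0 i * (i \in I)%:R.
  by rewrite mul_mx_diag !mxE.
have monE c : monomial I (c *m W^T) = (c *m M == o)%:R.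
  rewrite mulmxA; case: (boolP (_ == o)) => [/eqP eqo | neqo].
    apply: big1 => i iI; have /rowP/(_ i) := eqo.
    by rewrite !maskE iI !mulr1 => ->; rewrite mxE.
  have /rV0Pn[i] : c *m W^T *m row_mask 'F_2 I - o != 0 by rewrite subr_eq0.
  rewrite mxE [X in _ + X]mxE !maskE -mulrBl mulf_eq0 negb_or [const_mx _ _ _]mxE => /andP[ci].
  case: (boolP (i \in I)) => [iI _|]; last by rewrite eqxx.
  rewrite /monomial (bigD1 i) //=; case: (F2_cases ((c *m W^T) 0 i)) ci => ->.
    by rewrite mul0r.
  by rewrite subrr eqxx.
under eq_bigr do rewrite monE.
rewrite rows_free_mask -/M; case: (boolP (\rank M == #|I|)) => [rankM | rankM].
  have freeM : row_free M by rewrite /row_free (eqP rankM) cardI.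
  have sM : (M <= row_mask 'F_2 I)%MS by apply: submxMl.
  (* The rank of [M] is at least that of the mask, so the two row spaces coincide and the system is
     solvable. *)
  have sIM : (row_mask 'F_2 I <= M)%MS.
    rewrite -(mxrank_leqif_sup sM) eqn_leq mxrankS //=.
    by rewrite (eqP rankM) rank_row_mask.
  have /submxP[c0 oE] : (o <= M)%MS := submx_trans (submxMl _ _) sIM.
  rewrite (bigD1 c0) //= -oE eqxx big1 ?addr0 // => c neqc.
  by rewrite oE (inj_eq (row_free_inj freeM)) (negPf neqc).
have /rowV0Pn[a aK a0] : kermx M != 0.
  by rewrite kermx_eq0 /row_free -[X in _ == X]cardI.
apply: sum_shift_invariant_F2 a0 _ => c.
by rewrite mulmxDl (sub_kermxP aK) addr0.
Qed.

End MonomialSum.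

(** * Subspaces as column spaces *)

Section ColumnSpace.
Variables (F : fieldType) (n k : nat).
Implicit Types (W : 'M[F]_(n, k)) (U : {vspace 'rV[F]_n}).

Definition col_space W : {vspace 'rV[F]_n} :=
  limg (linfun (mulmxr W^T : 'rV_k -> 'rV_n)).

Lemma mem_col_space W x : (x \in col_space W) = (x <= W^T)%MS.
Proof.
apply/memv_imgP/submxP => [[c _ ->]|[c ->]]; exists c => //.
- by rewrite lfunE.
- by rewrite memvf.
- by rewrite lfunE.
Qed.

Lemma dim_col_space W : row_free W^T -> \dim (col_space W) = k.
Proof.
move=> freeW; rewrite limg_dim_eq ?dimvf /dim /= ?mul1n //.
apply/eqP; rewrite capfv -subv0; apply/subvP => c.
rewrite memv_ker lfunE memv0 /= => /eqP cW; apply/eqP.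
by apply: (row_free_inj freeW); rewrite mul0mx.
Qed.

Lemma eq_col_space W W' :
  (col_space W = col_space W') <-> (W^T :=: W'^T)%MS.
Proof.
split=> eqW; last first.
  by apply/vspaceP => x; rewrite !mem_col_space eqW.
by apply/eqmxP/andP; split; apply/row_subP => i;
  rewrite -mem_col_space (eqW, esym eqW) mem_col_space row_sub.
Qed.

Lemma col_spaceP U : \dim U = k ->
  exists2 W, row_free W^T & col_space W = U.
Proof.
move=> dimU; pose B : 'M[F]_(k, n) := \matrix_i (vbasis U)`_i.
have mulB (c : 'rV_k) : c *m B = \sum_i c 0 i *: (vbasis U)`_i.
  by rewrite mulmx_sum_row; apply: eq_bigr => i _; rewrite rowK.
exists B^T; rewrite ?trmxK.
  apply: inj_row_free => c; rewrite mulB => c0; apply/rowP => i; rewrite mxE.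
  have /freeP free := basis_free (vbasisP U).
  have := free (fun j => c 0 (cast_ord dimU j)) _ (cast_ord (esym dimU) i).
  rewrite cast_ordKV; apply; rewrite -[RHS]c0.
  rewrite [RHS](reindex (cast_ord dimU)) //=.
  by exists (cast_ord (esym dimU)) => j _; rewrite ?cast_ordK ?cast_ordKV.
apply/vspaceP => x; rewrite mem_col_space trmxK; apply/submxP/idP => [[c ->]|xU].
  rewrite mulB memv_suml // => i _; rewrite memvZ // vbasis_mem // mem_nth //.
  by rewrite size_tuple dimU.
exists (\row_i coord (vbasis U) (cast_ord (esym dimU) i) x).
rewrite mulB {1}(coord_vbasis xU) (reindex (cast_ord (esym dimU))) /=.
  by apply: eq_bigr => i _; rewrite mxE.
by exists (cast_ord dimU) => j _; rewrite ?cast_ordK ?cast_ordKV.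
Qed.

End ColumnSpace.

Lemma natr_F2_odd m : m%:R = (odd m)%:R :> 'F_2.
Proof.
rewrite -{1}[m]odd_double_half natrD -muln2 natrM.
by rewrite (_ : 2%:R = 0 :> 'F_2) ?mulr0 ?addr0 //; apply: val_inj.
Qed.

(** * From subspaces to matrices *)

Section Counting.
Variables (n k : nat) (f : boolfun n).
Hypothesis homf : homogeneous k f.
Implicit Types (W : 'M['F_2]_(n, k)).

Lemma sum_col_space W : row_free W^T ->
  \sum_(x in col_space W) f x = \sum_c f (c *m W^T).
Proof.
move=> freeW; transitivity (\sum_(x in [set c *m W^T | c : 'rV_k]) f x).
  apply: eq_bigl => x; rewrite mem_col_space.
  by apply/submxP/imsetP => [[c ->]|[c _ ->]]; exists c.
by rewrite big_imset //= => c c' _ _; apply: row_free_inj.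
Qed.

Lemma odd_rows_free W :
  odd #|[set I in anf f | rows_free I W]| = (\sum_c f (c *m W^T) != 0).
Proof.
have /forallP fE : is_anf f (anf f) by rewrite anfP.
under eq_bigr do rewrite (eqP (fE _)).
rewrite exchange_big /=.
rewrite (eq_bigr (fun I => (rows_free I W)%:R)) => [|I /homf]; last first.
  exact: sum_monomial.
rewrite -natr_sum natr_F2_odd -sum1dep_card big_mkcondr /=.
rewrite (eq_bigr (fun I => nat_of_bool (rows_free I W))); last first.
  by move=> I _; case: rows_free.
by case: odd.
Qed.

(** An odd count is nonzero, and [k] independent rows already force [W] to have rank [k]. *)
Lemma odd_row_free W :
  odd #|[set I in anf f | rows_free I W]| -> row_free W^T.
Proof.
move/odd_gt0; rewrite card_gt0 => /set0Pn[I]; rewrite inE => /andP[/homf cardI].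
rewrite rows_free_mask cardI => /eqP rankM.
rewrite /row_free eqn_leq rank_leq_row -{1}rankM.
by rewrite mxrankM_maxl.
Qed.

(** Each fibre of [col_space] over [Nset k f] is an orbit [W0 *m P] with [P] in GL_k; for square
    [P], [rows_free setT P] means invertibility. *)
Lemma card_odd_rows_free :
  #|[set W : 'M['F_2]_(n, k) | odd #|[set I in anf f | rows_free I W]| ]|
  = (#|Nset k f| * #|[set P : 'M['F_2]_k | rows_free setT P]|)%N.
Proof.
rewrite -sum1_card (partition_big (@col_space 'F_2 n k) (mem (Nset k f))) /=; last first.
  move=> W; rewrite inE => oddW; have freeW := odd_row_free oddW.
  by rewrite inE dim_col_space // eqxx sum_col_space // -odd_rows_free.
rewrite -sum_nat_const; apply: eq_bigr => U; rewrite inE => /andP[/eqP dimU fU].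
have [W0 freeW0 defU] := col_spaceP dimU.
have fullW0 : row_full W0 by rewrite /row_full -mxrank_tr.
rewrite sum1dep_card -(card_imset _ (row_full_inj fullW0)).
apply: eq_card => W; rewrite !inE; apply/andP/imsetP => [[oddW /eqP eqU]|[P]].
  (* Equal column spaces factor [W] through [W0], and the factor has rank [k] because [W] does. *)
  have /eq_col_space eqW : col_space W = col_space W0 by rewrite eqU.
  have /submxP[X WX] : (W^T <= W0^T)%MS by rewrite eqW.
  exists X^T; last by rewrite -[W]trmxK WX trmx_mul trmxK.
  rewrite inE rows_free_setT /row_free mxrank_tr eqn_leq rank_leq_row.
  by rewrite -{1}(eqP (odd_row_free oddW)) WX mxrankM_maxl.
(* Conversely, [P] preserves the column space, and the parity is read off the sum of [f] over that
   space. *)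
rewrite inE rows_free_setT => freeP ->.
have fullP : row_full P^T by rewrite /row_full mxrank_tr.
have eqW : ((W0 *m P)^T :=: W0^T)%MS by rewrite trmx_mul; apply: eqmxMfull.
have eqU : col_space (W0 *m P) = U by rewrite -defU; apply/eq_col_space.
rewrite odd_rows_free -sum_col_space ?eqU //.
by rewrite /row_free eqW.
Qed.

End Counting.

(** The order of GL_k over F_2: the case [n = k] of [card_rows_free], where the powers of 2
    cancel. *)
Lemma card_rows_free_setT k :
  #|[set P : 'M['F_2]_k | rows_free setT P]|%:R
  = \prod_(0 <= i < k) (2 ^+ k - 2 ^+ i) :> rat.
Proof.
have := @card_rows_free 'F_2 k k setT; rewrite cardsT card_ord => /(_ erefl).
by rewrite card_Fp // [RHS]mulrC => /mulIf; apply; rewrite expf_neq0.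
Qed.

Theorem theorem5p5 (n k d t : nat) (f : boolfun n)
    (ht : #|anf f| = t)
    (hhom : homogeneous k f)
    (hint : d_intersecting d f) :
  #|Nset k f|%:R =
    \sum_(1 <= l < t.+1)
      (- 2) ^+ (l - 1) * 'C(t, l)%:R
      * 2 ^ (k%:Z * (n%:Z - l%:Z * k%:Z + (l%:Z - 1) * d%:Z))
      * \prod_(0 <= i < k - d) (2 ^+ k - 2 ^+ (i + d)) ^+ (l - 1) :> rat.
Proof.
case: hint => _ [D cardD intD].
pose G : rat := \prod_(0 <= i < k) (2 ^+ k - 2 ^+ i).
have G0 : G != 0.
  rewrite /G big_mkord; apply/prodf_neq0 => i _.
  by rewrite subr_eq0 eq_sym lt_eqF // ltr_eXn2l.
(* The number of matrices independent on [l] given monomials, with the factor [G], the order of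
   GL_k, removed. *)
pose p (l : nat) : rat :=
  2 ^ (k%:Z * (n%:Z - l%:Z * k%:Z + (l%:Z - 1) * d%:Z))
  * \prod_(0 <= i < k - d) (2 ^+ k - 2 ^+ (i + d)) ^+ (l - 1).
have cardS (S : {set {set 'I_n}}) : (S \subset anf f) && (S != set0) ->
    #|[set W : 'M['F_2]_(n, k) | [forall I in S, rows_free I W]]|%:R
    = G * p #|S|.
  case/andP=> /subsetP sSf S0.
  have lt0S : (0 < #|S|)%N by rewrite card_gt0.
  have homS : {in S, forall I : {set _}, #|I| = k} by move=> I /sSf/hhom.
  have intS : {in S &, forall I J : {set _}, I != J -> I :&: J = D}.
    by move=> I J /sSf If /sSf Jf; apply: intD.
  have := @card_rows_free_sunflower 'F_2 n k D S S0 homS intS.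
  rewrite card_Fp // cardD -/G -{2}(add0n d) big_addn /p prodrXl.
  set A := #|_|%:R; set P := \prod_(_ <= i < _) _.
  have -> : 2 ^+ (n * k) = 2 ^+ (k * k) * 2 ^+ (k * (k - d)) ^+ (#|S| - 1)
     * 2 ^ (k%:Z * (n%:Z - #|S|%:Z * k%:Z + (#|S|%:Z - 1) * d%:Z)) :> rat.
    rewrite -exprM -exprD !exprnP -expfzDr //; congr (_ ^ _).
    (* The truncated [k - d] must agree with the integer difference. For one set its exponent
       [#|S| - 1] is 0; two distinct sets meet in [D], so [d <= k]. *)
    have [le1S | gt1S] := leqP #|S| 1.
      have -> : #|S| = 1%N by apply/eqP; rewrite eqn_leq le1S.
      by rewrite subnn muln0 addn0 !PoszM; ring.
    have /card_gt1P[I [J [IS JS neqIJ]]] := gt1S.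
    have led : (d <= k)%N.
      by rewrite -cardD -(intS I J) // -(homS I IS) subset_leq_card ?subsetIl.
    by rewrite !PoszD !PoszM -!subzn //; ring.
  set B := 2 ^+ (k * k) * _; set Z := 2 ^ _ => eqB.
  have B0 : B != 0 by rewrite !(mulf_neq0, expf_neq0).
  apply: (mulIf B0); rewrite eqB; move: (P ^+ _) => Q.
  by clearbody A B G Z; ring.
(* Multiplied by [G], the left side counts the matrices with an odd number of independent
   selections. *)
apply: (mulIf G0); rewrite -{1}(card_rows_free_setT k : _ = G) -natrM.
rewrite -card_odd_rows_free //.
rewrite natr_card; under eq_bigr do rewrite natr_odd_card.
rewrite (exchange_big_dep (fun S : {set {set 'I_n}} => (S \subset anf f) && (S != set0))) /=; last first.
  move=> W S _ /andP[/subset_trans sS ->]; rewrite andbT; apply: sS.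
  by apply/subsetP => I; rewrite inE => /andP[].
(* The contribution of [S] depends only on its size, so grouping by size produces the binomial
   coefficients. *)
pose g l : rat := (- 2) ^+ (l - 1) * (G * p l).
rewrite (eq_bigr (fun S : {set {set 'I_n}} => g #|S|)); last first.
  move=> S hS; have /andP[sSf S0] := hS; rewrite /g -cardS // sumr_const mulr_natr.
  congr (_ *+ _); apply: eq_card => W; rewrite [RHS]inE [LHS]unfold_in /= S0 andbT.
  apply/subsetP/forall_inP => [free I /free|free I IS].
    by rewrite inE => /andP[].
  by rewrite inE (subsetP sSf) ?free.
rewrite sum_subset_card ht mulr_suml; apply: eq_bigr => l _.
rewrite /g /p; set Z := 2 ^ _; set P := \prod_(_ <= _ < _) _.
set E := (- 2) ^+ _; by clearbody G E Z P; ring.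
Qed.
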